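(* Let $L,M$ be locales and let $f\colon L\to M$ be an arbitrary function. Define $f_{\mathfrak c}^{\to}\colon \mathfrak c L\to\mathfrak c M$ by $f_{\mathfrak c}^{\to}(\mathfrak c(a))=\mathrm{cl}(f[\mathfrak c(a)])$ and $f_{\mathfrak c}^{\leftarrow}\colon \mathfrak c M\to\mathfrak c L$ by $f_{\mathfrak c}^{\leftarrow}(\mathfrak c(b))=\mathrm{cl}(f^{-1}[\mathfrak c(b)])$. Then $(f_{\mathfrak c}^{\to},f_{\mathfrak c}^{\leftarrow})$ is an adjoint pair, i.e. $f_{\mathfrak c}^{\to}\dashv f_{\mathfrak c}^{\leftarrow}$, if and only if $f$ preserves arbitrary meets.
   Context: A locale (= frame) is a complete lattice $L$ with $(\bigvee A)\wedge b=\bigvee\{a\wedge b\mid a\in A\}$ for all $A\subseteq L$, $b\in L$. For $a\in L$, $\mathfrak c(a)=\{x\in L\mid x\ge a\}$ is the closed sublocale associated with $a$; $\mathfrak c L=\{\mathfrak c(a)\mid a\in L\}$, ordered by inclusion. For any subset $S\subseteq L$, $\mathrm{cl}\,S=\mathfrak c(\bigwedge S)$, the smallest closed sublocale containing $S$. For posets $X,Y$, a pair $(g,h)$ of order-preserving maps $g\colon X\to Y$, $h\colon Y\to X$ is an adjoint pair, written $g\dashv h$, if $g(x)\le y\iff x\le h(y)$ for all $x\in X$, $y\in Y$. Arbitrary meets include the empty meet $1$. *)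

(* Defs.v *)
From HB Require Import structures.
From mathcomp Require Import all_boot all_order.
From mathcomp Require Import boolp classical_sets.

Set Implicit Arguments.
Unset Strict Implicit.
Unset Printing Implicit Defensive.

Import Order.TTheory.
Local Open Scope classical_set_scope.
Local Open Scope order_scope.

(* Infinitary joins and meets range over all subsets, including the empty one;
   supremums A and infimums A contain at most one element by antisymmetry. *)
HB.mixin Record isCompleteLattice d L of Order.Lattice d L := {
  bigjoin : set L -> L;
  bigmeet : set L -> L;
  bigjoinP : forall A : set L, supremums A (bigjoin A);
  bigmeetP : forall A : set L, infimums A (bigmeet A)
}.

#[short(type="completeLatticeType")]
HB.structure Definition CompleteLattice d :=
  { L of Order.Lattice d L & isCompleteLattice d L }.

HB.mixin Record isLocale d L of CompleteLattice d L := {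
  bigjoinIl : forall (A : set L) (b : L),
    bigjoin A `&` b = bigjoin [set a `&` b | a in A]
}.

#[short(type="localeType")]
HB.structure Definition Locale d := { L of CompleteLattice d L & isLocale d L }.

Definition upset d (L : localeType d) (a : L) : set L :=
  [set x | a <= x].

(* The poset of closed sublocales c(a) = upset a, ordered by inclusion: the order is
   inherited from the inclusion order of set L. *)
Record closed_sublocale d (L : localeType d) := ClosedSublocale {
  csval :> set L;
  csvalP : `[< exists a : L, csval = upset a >]
}.

Section ClosedSublocalePOrder.
Context d (L : localeType d).
HB.instance Definition _ := [isSub for @csval d L].
HB.instance Definition _ := [Choice of closed_sublocale L by <:].
HB.instance Definition _ :=
  [SubChoice_isSubPOrder of closed_sublocale L by <: with set_display].
End ClosedSublocalePOrder.

Lemma le_closed_sublocaleE d (L : localeType d) (C D : closed_sublocale L) :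
  (C <= D) = (csval C `<=` csval D) :> Prop.
Proof. by rewrite -subsetEset. Qed.

Lemma upset_closed d (L : localeType d) (a : L) :
  `[< exists a' : L, upset a = upset a' >].
Proof. by apply/asboolP; exists a. Qed.

Definition csub d (L : localeType d) (a : L) : closed_sublocale L :=
  ClosedSublocale (upset_closed a).

Definition cl d (L : localeType d) (S : set L) : closed_sublocale L :=
  csub (bigmeet S).

Lemma sub_cl d (L : localeType d) (S : set L) : S `<=` cl S.
Proof. by case: (bigmeetP S) => lbS _ x /lbS. Qed.

Lemma cl_min d (L : localeType d) (S : set L) (C : closed_sublocale L) :
  S `<=` C -> cl S <= C.
Proof.
case: C => C CP /= SC; rewrite le_closed_sublocaleE /=.
case/asboolP: (CP) => a eC; rewrite eC in SC *.
by case: (bigmeetP S) => _ /(_ a SC) aS x; apply: le_trans.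
Qed.

Definition cimage d d' (L : localeType d) (M : localeType d') (f : L -> M)
  (C : closed_sublocale L) : closed_sublocale M := cl (f @` C).

Definition cpreimage d d' (L : localeType d) (M : localeType d') (f : L -> M)
  (D : closed_sublocale M) : closed_sublocale L := cl (f @^-1` D).

Definition adjoint_pair d d' (X : porderType d) (Y : porderType d')
    (g : X -> Y) (h : Y -> X) : Prop :=
  [/\ {homo g : x x' / x <= x'},
      {homo h : y y' / y <= y'} &
      forall x y, g x <= y <-> x <= h y].

Definition preserves_meets d d' (L : localeType d) (M : localeType d')
    (f : L -> M) : Prop :=
  forall A : set L, f (bigmeet A) = bigmeet (f @` A).

(* Main.v *)
(* The pair is adjoint iff every preimage of a closed sublocale is closed: the
   counit at c(b) says that f maps cl(f^-1[c(b)]) into c(b).  And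
   f^-1[c(b)] = c(g b) means b <= f x iff g b <= x, i.e. g is a lower adjoint
   of f; such a g exists iff f preserves meets. *)
Require Import Defs.
From mathcomp Require Import all_boot all_order.
From mathcomp Require Import boolp classical_sets.

Set Implicit Arguments.
Unset Strict Implicit.
Unset Printing Implicit Defensive.

Import Order.TTheory.
Local Open Scope classical_set_scope.
Local Open Scope order_scope.

Lemma le_bigmeetP d (L : localeType d) (A : set L) (b : L) :
  b <= bigmeet A <-> (forall x, A x -> b <= x).
Proof.
have [lbA glbA] := bigmeetP A; split=> [bA x Ax | bA].
  exact: le_trans bA (lbA x Ax).
exact: glbA.
Qed.

Lemma bigmeet_le d (L : localeType d) (A : set L) (x : L) :
  A x -> bigmeet A <= x.
Proof. by move=> Ax; have [lbA _] := bigmeetP A; exact: lbA. Qed.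

Lemma bigmeet_upset d (L : localeType d) (a : L) : bigmeet (upset a) = a.
Proof.
by apply/le_anti/andP; split; [exact: bigmeet_le (lexx a) | apply/le_bigmeetP].
Qed.

Lemma cl_leP d (L : localeType d) (S : set L) (C : closed_sublocale L) :
  cl S <= C <-> S `<=` C.
Proof.
split=> [|]; last exact: cl_min.
by rewrite le_closed_sublocaleE => SC x Sx; apply: SC; exact: sub_cl.
Qed.

Lemma cl_le d (L : localeType d) (S T : set L) : S `<=` T -> cl S <= cl T.
Proof. by move=> ST; apply/cl_leP => x /ST; exact: sub_cl. Qed.


Section LowerAdjoint.
Context d d' (L : localeType d) (M : localeType d') (f : L -> M).

Lemma lower_adjoint_preserves_meets (g : M -> L) :
  (forall b x, g b <= x <-> b <= f x) -> preserves_meets f.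
Proof.
move=> gf A; apply/le_anti/andP; split.
  apply/le_bigmeetP => _ [x Ax <-].
  (* Monotonicity of [f] is not given: transposing along [gf] leaves
     [g (f (bigmeet A)) <= bigmeet A <= x]. *)
  by apply/gf/(le_trans _ (bigmeet_le Ax))/gf.
apply/gf/le_bigmeetP => x Ax; apply/gf.
by apply: bigmeet_le; exists x.
Qed.

(** Since [x] is the meet of [upset x], [f x] is the meet of an image that contains [f y]. *)
Lemma preserves_meets_homo : preserves_meets f -> {homo f : x y / x <= y}.
Proof.
move=> fmeet x y xy; rewrite -[x]bigmeet_upset fmeet.
by apply: bigmeet_le; exists y.
Qed.

(** The meet of the preimage is itself sent above [b], being sent to a meet of values above [b];
    monotonicity of [f] does the rest. *)
Lemma preserves_meets_lower_adjoint (b : M) (x : L) :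
  preserves_meets f -> bigmeet (f @^-1` upset b) <= x <-> b <= f x.
Proof.
move=> fmeet; split=> [|bx]; last exact: bigmeet_le.
move/(preserves_meets_homo fmeet); apply: le_trans.
by rewrite fmeet; apply/le_bigmeetP => _ [y b_le_fy <-].
Qed.

(** Direct image is left adjoint to preimage on subsets, and the closure on the left is absorbed
    because [D] is closed. *)
Lemma cimage_leP (C : closed_sublocale L) (D : closed_sublocale M) :
  cimage f C <= D <-> C `<=` f @^-1` D.
Proof.
split=> [/cl_leP fCD x Cx | CD]; first by apply: fCD; exists x.
by apply/cl_leP => _ [x Cx <-]; exact: CD.
Qed.

Lemma adjoint_pair_closed_preimage :
  adjoint_pair (cimage f) (cpreimage f) <->
  forall D : closed_sublocale M, f @^-1` D = cpreimage f D.
Proof.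
split=> [[_ _ adj] D | closedf].
  apply/seteqP; split; first exact: sub_cl.
  by apply/cimage_leP/adj.
split=> [C C' | D D' | C D].
- by rewrite le_closed_sublocaleE => CC'; exact/cl_le/image_subset.
- by rewrite le_closed_sublocaleE => DD'; apply: cl_le => x /DD'.
- by rewrite cimage_leP closedf le_closed_sublocaleE.
Qed.

End LowerAdjoint.

Theorem proposition3p1p3 (d d' : Order.disp_t)
    (L : localeType d) (M : localeType d') (f : L -> M) :
  adjoint_pair (cimage f) (cpreimage f) <-> preserves_meets f.
Proof.
rewrite adjoint_pair_closed_preimage; split=> [closedf | fmeet [D DP]].
  apply: (@lower_adjoint_preserves_meets _ _ _ _ _
           (fun b => bigmeet (f @^-1` upset b))) => b x.
  have /seteqP[sub sup] := closedf (csub b).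
  by split=> [/sup | /sub].
apply/seteqP; split; first exact: sub_cl.
(* Writing [D] as [upset b] turns membership of [x] in the closure into [x] lying above the meet of
   the preimage. *)
case/asboolP: (DP) => b /= -> x.
by move/(preserves_meets_lower_adjoint b x fmeet).
Qed.
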